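(* Let $(X,\to,{}^*,1)$ be a quantum-Wajsberg algebra with $0=1^*$, and let $\mathcal{O}(X)=\{x\in X\mid x=x^*\to x\}$. For $x,y\in\mathcal{O}(X)$ define $x\Cup_L y=x^*\to y$ and $x\Cap_L y=x\odot y$. Then $(\mathcal{O}(X),\Cap_L,\Cup_L,{}^*,0,1)$ is an orthomodular lattice.
   Context: A BE algebra is an algebra $(X,\to,1)$ of type $(2,0)$ such that for all $x,y,z\in X$: $x\to x=1$; $x\to 1=1$; $1\to x=x$; $x\to(y\to z)=y\to(x\to z)$. It is bounded if there is $0\in X$ with $0\to x=1$ for all $x$; then $x^*:=x\to 0$. A bounded BE algebra is involutive if $x^{**}=x$ for all $x$; it is written $(X,\to,{}^*,1)$, with $0=1^*$. In an involutive BE algebra put $x\Cap y=((x^*\to y^* )\to y^* )^*$ and $x\odot y=(x\to y^* )^*$. A quantum-Wajsberg algebra is an involutive BE algebra $(X,\to,{}^*,1)$ satisfying, for all $x,y,z\in X$, $x\to((x\Cap y)\Cap(z\Cap x))=(x\to y)\Cap(x\to z)$. An orthomodular lattice is an algebra $(L,\wedge,\vee,{}',0,1)$ such that $(L,\wedge,\vee,0,1)$ is a bounded lattice and for all $x,y\in L$: $x\wedge x'=0$, $x\vee x'=1$; $(x\wedge y)'=x'\vee y'$, $(x\vee y)'=x'\wedge y'$; $(x')'=x$; and $x\le y$ implies $x\vee(x'\wedge y)=y$ (where $x\le y$ iff $x=x\wedge y$). *)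

(* Defs.v *)
From mathcomp Require Import ssreflect ssrfun ssrbool.

Set Implicit Arguments.
Unset Strict Implicit.
Unset Printing Implicit Defensive.

Record is_BE_algebra (X : Type) (imp : X -> X -> X) (one : X) : Prop := {
  BE_refl : forall x, imp x x = one;
  BE_top : forall x, imp x one = one;
  BE_unit : forall x, imp one x = x;
  BE_exchange : forall x y z, imp x (imp y z) = imp y (imp x z)
}.

(* The bottom element need not be unique in a bounded BE algebra; it is        *)
(* recovered from the signature as [zero = star one], by [BE_unit].             *)
Record is_involutive_BE_algebra (X : Type)
    (imp : X -> X -> X) (star : X -> X) (one : X) : Prop := {
  invBE_BE : is_BE_algebra imp one;
  invBE_bounded : exists zero : X,
    (forall x, imp zero x = one) /\ (forall x, star x = imp x zero);
  invBE_star : involutive star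
}.

Definition qcap (X : Type) (imp : X -> X -> X) (star : X -> X) (x y : X) : X :=
  star (imp (imp (star x) (star y)) (star y)).

Definition qodot (X : Type) (imp : X -> X -> X) (star : X -> X) (x y : X) : X :=
  star (imp x (star y)).

Definition OX (X : Type) (imp : X -> X -> X) (star : X -> X) : Type :=
  {x : X | x = imp (star x) x}.

Record is_quantum_Wajsberg_algebra (X : Type)
    (imp : X -> X -> X) (star : X -> X) (one : X) : Prop := {
  qW_invBE : is_involutive_BE_algebra imp star one;
  qW_axiom : forall x y z,
    imp x (qcap imp star (qcap imp star x y) (qcap imp star z x)) =
    qcap imp star (imp x y) (imp x z)
}.

Definition lat_le (L : Type) (meet : L -> L -> L) (x y : L) : Prop :=
  x = meet x y.

Record is_bounded_lattice (L : Type)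
    (meet join : L -> L -> L) (bot top : L) : Prop := {
  lat_meetC : commutative meet;
  lat_joinC : commutative join;
  lat_meetA : associative meet;
  lat_joinA : associative join;
  lat_meetK : forall x y, meet x (join x y) = x;
  lat_joinK : forall x y, join x (meet x y) = x;
  lat_bot : forall x, lat_le meet bot x;
  lat_top : forall x, lat_le meet x top
}.

Record is_orthomodular_lattice (L : Type)
    (meet join : L -> L -> L) (compl : L -> L) (bot top : L) : Prop := {
  oml_lattice : is_bounded_lattice meet join bot top;
  oml_meet_compl : forall x, meet x (compl x) = bot;
  oml_join_compl : forall x, join x (compl x) = top;
  oml_compl_meet : forall x y, compl (meet x y) = join (compl x) (compl y);
  oml_compl_join : forall x y, compl (join x y) = meet (compl x) (compl y);
  oml_compl_inv : involutive compl;
  oml_orthomodular : forall x y,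
    lat_le meet x y -> join x (meet (compl x) y) = y
}.

(* Main.v *)
Require Import Defs.
From mathcomp Require Import ssreflect ssrfun ssrbool.
From Stdlib Require Import ProofIrrelevance.

Set Implicit Arguments.
Unset Strict Implicit.
Unset Printing Implicit Defensive.

(** Write [x + y] for [imp (star x) y] and [x * y] for its De Morgan dual
    [qodot x y]; these are commutative and associative.  The quantum-Wajsberg
    axiom at [x*] with [y = 0] gives [x cap (x + z) = x]; at [x] with [y = x*]
    and [z = 1] it shows that [x + x = x] implies [x* + x* = x*].  Hence the
    idempotents of [+] are closed under the three operations.  If [w = x + y] is
    idempotent, then [x = x cap w = (x + w* ) * w] gives [x * w = x], which is
    absorption.  Finally [x = x * y] means [x* = x* + y*], and then
    [y* cap x* = y*] is the dual of the orthomodular law. *)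

Section QuantumWajsberg.

Context (X : Type) (imp : X -> X -> X) (star : X -> X) (one : X).
Hypothesis qW : is_quantum_Wajsberg_algebra imp star one.

Local Notation add x y := (imp (star x) y).
Local Notation mul := (qodot imp star).
Local Notation cap := (qcap imp star).
Local Notation zero := (star one).

Let BE := invBE_BE (qW_invBE qW).
Let starK := invBE_star (qW_invBE qW).

(** The bottom element [z] is only given existentially; [star one = imp one z = z] identifies it. *)
Lemma star_imp0 x : star x = imp x zero.
Proof.
have [z [_ starE]] := invBE_bounded (qW_invBE qW).
by rewrite (starE one) (BE_unit BE) starE.
Qed.

(** Exchange swaps the premises [x] and [star y] of the conclusion [zero]. *)
Lemma imp_contra x y : imp x y = imp (star y) (star x).
Proof. by rewrite -{1}(starK y) (star_imp0 (star y)) (BE_exchange BE) -star_imp0. Qed.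

Lemma addC x y : add x y = add y x.
Proof. by rewrite imp_contra starK. Qed.

Lemma addA x y z : add x (add y z) = add (add x y) z.
Proof. by rewrite (addC y z) (BE_exchange BE) addC. Qed.

Lemma add0 x : add x zero = x.
Proof. by rewrite -star_imp0 starK. Qed.

Lemma imp0 x : imp zero x = one.
Proof. by rewrite imp_contra starK (BE_top BE). Qed.

Lemma star_add x y : star (add x y) = mul (star x) (star y).
Proof. by rewrite /qodot starK. Qed.

Lemma star_mul x y : star (mul x y) = add (star x) (star y).
Proof. by rewrite /qodot !starK. Qed.

Lemma mulC x y : mul x y = mul y x.
Proof. by rewrite /qodot imp_contra starK. Qed.

Lemma mulA x y z : mul x (mul y z) = mul (mul x y) z.
Proof. by apply: (inv_inj starK); rewrite !star_mul addA. Qed.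

Lemma mul_star x : mul x (star x) = zero.
Proof. by rewrite /qodot starK (BE_refl BE). Qed.

Lemma capE x y : cap x y = mul (add x (star y)) y.
Proof. by []. Qed.

Lemma cap0 x : cap x zero = zero.
Proof. by rewrite /qcap starK !(BE_top BE). Qed.

Lemma cap0x x : cap zero x = zero.
Proof. by rewrite /qcap starK (BE_unit BE) (BE_refl BE). Qed.

Lemma cap1 x : cap x one = x.
Proof. by rewrite /qcap -!star_imp0 !starK. Qed.

Lemma cap_addr x z : cap x (add x z) = x.
Proof.
have := qW_axiom qW (star x) zero z.
by rewrite cap0 cap0x add0 => <-.
Qed.

Lemma idem_star x : x = add x x -> star x = add (star x) (star x).
Proof.
move=> idx; have := qW_axiom qW x (star x) one.
(* On the left, [cap x (star x)] is [mul (add x x) (star x)], which idempotence turns into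
   [mul x (star x) = zero]; on the right, the meet with [one] leaves [imp x (star x)]. *)
by rewrite (BE_top BE) cap1 (capE x) starK -idx mul_star cap0x -star_imp0.
Qed.

Lemma idem_add x y : x = add x x -> y = add y y ->
  add x y = add (add x y) (add x y).
Proof.
by move=> idx idy; rewrite addA -(addA x y x) (addC y x) addA -idx -addA -idy.
Qed.

Lemma idem_mul x y : x = add x x -> y = add y y ->
  mul x y = add (mul x y) (mul x y).
Proof.
move=> idx idy; rewrite -(starK (mul x y)); apply: idem_star.
by rewrite star_mul; apply: idem_add; apply: idem_star.
Qed.

Lemma idem_mulxx x : x = add x x -> mul x x = x.
Proof. by move=> /idem_star; rewrite starK /qodot => <-; rewrite starK. Qed.

Lemma mul_addK x y : x = add x x -> y = add y y -> mul x (add x y) = x.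
Proof.
move=> idx idy; rewrite -{1}(cap_addr x y) capE -mulA idem_mulxx.
  by rewrite -capE cap_addr.
exact: idem_add.
Qed.

Lemma add_mulK x y : x = add x x -> y = add y y -> add x (mul x y) = x.
Proof.
move=> idx idy; apply: (inv_inj starK).
by rewrite star_add star_mul mul_addK //; apply: idem_star.
Qed.

Lemma add_mul_star x y : x = mul x y -> add x (mul (star x) y) = y.
Proof.
move=> xy; apply: (inv_inj starK).
have sx : star x = add (star y) (star x) by rewrite {1}xy star_mul addC.
rewrite star_add star_mul mulC starK.
(* After starring, the goal is [mul (add x (star y)) (star x) = star y], whose left side is
   [cap (star y) (star x)]; by [sx] the second argument is a sum with [star y]. *)
by have := cap_addr (star y) (star x); rewrite -sx capE addC !starK.
Qed.

Lemma idem_one : one = add one one.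
Proof. by rewrite (BE_top BE). Qed.

(** As [X] is an arbitrary type, proof irrelevance is what identifies two membership proofs. *)
Lemma OX_eq (x y : OX imp star) : sval x = sval y -> x = y.
Proof.
by case: x y => [x px] [y py] /= xy; apply: subset_eq_compat.
Qed.

End QuantumWajsberg.

Theorem theorem5p9 (X : Type) (imp : X -> X -> X) (star : X -> X) (one : X)
    (qW : is_quantum_Wajsberg_algebra imp star one) :
  exists (meetL joinL : OX imp star -> OX imp star -> OX imp star)
         (starL : OX imp star -> OX imp star) (zeroL oneL : OX imp star),
    (forall x y, sval (meetL x y) = qodot imp star (sval x) (sval y)) /\
    (forall x y, sval (joinL x y) = imp (star (sval x)) (sval y)) /\
    (forall x, sval (starL x) = star (sval x)) /\
    sval zeroL = star one /\
    sval oneL = one /\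
    is_orthomodular_lattice meetL joinL starL zeroL oneL.
Proof.
have BE := invBE_BE (qW_invBE qW); have starK := invBE_star (qW_invBE qW).
pose mkO z (hz : z = imp (star z) z) : OX imp star := exist _ z hz.
exists (fun x y => mkO _ (idem_mul qW (svalP x) (svalP y))).
exists (fun x y => mkO _ (idem_add qW (svalP x) (svalP y))).
exists (fun x => mkO _ (idem_star qW (svalP x))).
(* Zero is idempotent as the star of the idempotent [one]. *)
exists (mkO _ (idem_star qW (idem_one qW))).
exists (mkO _ (idem_one qW)).
do 5![split=> //]; split.
- split.
  + by move=> x y; apply: OX_eq; apply: (mulC qW).
  + by move=> x y; apply: OX_eq; apply: (addC qW).
  + by move=> x y z; apply: OX_eq; apply: (mulA qW).
  + by move=> x y z; apply: OX_eq; apply: (addA qW).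
  + by move=> [x px] [y py]; apply: OX_eq; apply: (mul_addK qW px py).
  + by move=> [x px] [y py]; apply: OX_eq; apply: (add_mulK qW px py).
  + by move=> x; apply: OX_eq; rewrite /= /qodot (imp0 qW).
  + by move=> x; apply: OX_eq; rewrite /= /qodot -(star_imp0 qW) starK.
- by move=> x; apply: OX_eq; apply: (mul_star qW).
- by move=> x; apply: OX_eq; rewrite /= (BE_refl BE).
- by move=> x y; apply: OX_eq; apply: (star_mul qW).
- by move=> x y; apply: OX_eq; apply: (star_add qW).
- by move=> x; apply: OX_eq; apply: starK.
(* The order is an equation in the subtype; projecting it gives [x = mul x y] in [X]. *)
- by move=> [x px] [y py] /(congr1 sval) /= xy; apply: OX_eq; apply: (add_mul_star qW xy).
Qed.
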